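(* Let $K\ge 1$ and let $f=h+\overline{g}$ be a harmonic $K$-quasiregular mapping defined on the unit disc $\mathbb{D}$, where $h$ and $g$ are analytic in $\mathbb{D}$ with $$h(z)=\sum_{n=1}^{\infty} a_n z^n \quad\text{and}\quad g(z)=\sum_{n=1}^{\infty} b_n z^n .$$ If $\lambda$ is a constant such that $\lambda_f(z)\le \lambda$ for all $z\in\mathbb{D}$, then $$|a_n|+|b_n|\le \frac{K\lambda}{n}\qquad (n=1,2,\ldots).$$
   Context: $\mathbb{D}=\{z\in\mathbb{C}:|z|<1\}$. A complex-valued function $f=u+iv$ is harmonic if $u$ and $v$ are real-valued harmonic functions. For a continuously differentiable $f$, put $\Lambda_f=|f_z|+|f_{\bar z}|$, $\lambda_f=\big||f_z|-|f_{\bar z}|\big|$, and $J_f=|f_z|^2-|f_{\bar z}|^2$ (the Jacobian). A harmonic function $f$ is sense-preserving if $J_f(z)>0$ in its domain. A sense-preserving harmonic mapping $f$ on $\mathbb{D}$ is $K$-quasiregular ($K\ge1$) if $\Lambda_f^2\le K J_f$, equivalently $\Lambda_f\le K\lambda_f$, everywhere on $\mathbb{D}$. *)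

(* Defs.v *)
(* Stdlib real numbers with Coquelicot: C is R * R, with Cmod, Cconj, Cpow. *)
From Stdlib Require Import Reals.
From Coquelicot Require Import Coquelicot.

Open Scope R_scope.

Definition unit_disc (z : C) : Prop := Cmod z < 1.

(* Derive is total, so these are meaningful only where the partial derivative
   exists; C1_on supplies existence. *)
Definition partial_x (u : C -> R) (z : C) : R :=
  Derive (fun t : R => u (t, Im z)) (Re z).

Definition partial_y (u : C -> R) (z : C) : R :=
  Derive (fun t : R => u (Re z, t)) (Im z).

(* To be used with D open. *)
Definition C1_on (D : C -> Prop) (u : C -> R) : Prop :=
  forall z : C, D z ->
    ex_derive (fun t : R => u (t, Im z)) (Re z) /\
    ex_derive (fun t : R => u (Re z, t)) (Im z) /\
    continuous (partial_x u) z /\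
    continuous (partial_y u) z.

Definition C2_on (D : C -> Prop) (u : C -> R) : Prop :=
  C1_on D u /\ C1_on D (partial_x u) /\ C1_on D (partial_y u).

Definition real_harmonic_on (D : C -> Prop) (u : C -> R) : Prop :=
  C2_on D u /\
  forall z : C, D z ->
    partial_x (partial_x u) z + partial_y (partial_y u) z = 0.

Definition harmonic_on (D : C -> Prop) (f : C -> C) : Prop :=
  real_harmonic_on D (fun z => Re (f z)) /\
  real_harmonic_on D (fun z => Im (f z)).

Definition Cpartial_x (f : C -> C) (z : C) : C :=
  (partial_x (fun w => Re (f w)) z, partial_x (fun w => Im (f w)) z).

Definition Cpartial_y (f : C -> C) (z : C) : C :=
  (partial_y (fun w => Re (f w)) z, partial_y (fun w => Im (f w)) z).

(* Wirtinger derivatives f_z = (f_x - i f_y) / 2, f_zbar = (f_x + i f_y) / 2. *)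
Definition d_z (f : C -> C) (z : C) : C :=
  ((Cpartial_x f z - Ci * Cpartial_y f z) / 2)%C.

Definition d_zbar (f : C -> C) (z : C) : C :=
  ((Cpartial_x f z + Ci * Cpartial_y f z) / 2)%C.

Definition Lambda_max (f : C -> C) (z : C) : R :=
  Cmod (d_z f z) + Cmod (d_zbar f z).

Definition lambda_min (f : C -> C) (z : C) : R :=
  Rabs (Cmod (d_z f z) - Cmod (d_zbar f z)).

Definition Jacobian (f : C -> C) (z : C) : R :=
  Cmod (d_z f z) ^ 2 - Cmod (d_zbar f z) ^ 2.

Definition sense_preserving_on (D : C -> Prop) (f : C -> C) : Prop :=
  forall z : C, D z -> 0 < Jacobian f z.

Definition harmonic_quasiregular (K : R) (f : C -> C) : Prop :=
  harmonic_on unit_disc f /\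
  sense_preserving_on unit_disc f /\
  forall z : C, unit_disc z -> Lambda_max f z ^ 2 <= K * Jacobian f z.

Definition analytic_on (D : C -> Prop) (h : C -> C) : Prop :=
  forall z : C, D z -> @ex_derive C_AbsRing C_NormedModule h z.

(* h(z) is the sum of the a_n z^n over n >= 1; the value a 0 plays no role. *)
Definition power_series_from_1 (D : C -> Prop) (a : nat -> C) (h : C -> C)
  : Prop :=
  forall z : C, D z ->
    @is_series C_AbsRing C_NormedModule
      (fun n : nat => (a (S n) * Cpow z (S n))%C) (h z).

(* Main.v *)
Require Import Defs.
From Stdlib Require Import Reals Lra Lia.
From Coquelicot Require Import Coquelicot.

Open Scope R_scope.

(* Since f_z = h' and f_zbar = conj g', quasiregularity gives
   |h'| + |g'| = Lambda_f <= K lambda_f <= K lambda, so F = h + c g satisfies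
   |F'| <= K lambda for every unimodular c.  Cauchy's estimate for F', at a c
   that aligns b_n with a_n, is the claim.  Complex integration and termwise
   differentiation are avoided: Cauchy's estimate for a convergent power series
   is an average over roots of unity, and it is applied to F(e^{it} z) - F(z),
   which is bounded by K lambda r t on |z| = r; then t -> 0 and r -> 1. *)

(** * Complex derivatives seen through real calculus *)

(** Taking [Re (c * _)] makes everything real-valued, so that real calculus applies. The free factor
    [c] loses no information: it recovers real and imaginary parts as well as the modulus. *)
Lemma filterdiff_Re_mult (h : C -> C) (z l c : C)
  (hd : @is_derive C_AbsRing C_NormedModule h z l) :
  @filterdiff R_AbsRing C_R_NormedModule R_NormedModule
    (fun u => Re (c * h u)) (locally z) (fun u => Re (c * (l * u))).
Proof.
  split.
  - split.
    + intros [u1 u2] [v1 v2]. unfold plus; simpl. unfold plus; simpl. ring.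
    + intros k [u1 u2]. unfold scal; simpl; unfold scal; simpl; unfold mult; simpl. ring.
    + exists (Cmod c * Cmod l + 1). split.
      * generalize (Cmod_ge_0 c) (Cmod_ge_0 l); intros; nra.
      * intros u. rewrite <- Cmod_norm.
        change (norm (Re (c * (l * u)))) with (Rabs (Re (c * (l * u)))).
        eapply Rle_trans; [apply re_le_Cmod|].
        rewrite !Cmod_mult. generalize (Cmod_ge_0 u). nra.
  - intros x Hx. rewrite <- (is_filter_lim_locally_unique _ _ Hx). clear x Hx.
    intros eps.
    destruct hd as [_ hd].
    assert (Hc : 0 < eps / (Cmod c + 1)).
    { apply Rdiv_lt_0_compat; [apply cond_pos|generalize (Cmod_ge_0 c); lra]. }
    specialize (hd z (fun P H => H) (mkposreal _ Hc)).
    destruct hd as [d hd].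
    (* Real neighbourhoods in [C] are squares, complex ones are discs: the square of half-side
       [d / sqrt 2] lies in the disc of radius [d]. *)
    assert (Hd : 0 < d / sqrt 2).
    { apply Rdiv_lt_0_compat; [apply cond_pos|apply Rlt_sqrt2_0]. }
    exists (mkposreal _ Hd). intros u Hu.
    assert (Hu' : Cmod (u - z) < d).
    { replace (pos d) with (sqrt 2 * mkposreal _ Hd).
      - apply C_NormedModule_mixin_compat2. exact Hu.
      - simpl. field. generalize Rlt_sqrt2_0; lra. }
    specialize (hd u Hu'). simpl in hd.
    change (Cmod (h u - h z - (u - z) * l) <= eps / (Cmod c + 1) * Cmod (u - z)) in hd.
    rewrite <- Cmod_norm.
    change (Rabs (Re (c * h u) - Re (c * h z) - Re (c * (l * (u - z))))
      <= eps * Cmod (u - z)).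
    replace (Re (c * h u) - Re (c * h z) - Re (c * (l * (u - z))))
      with (Re (c * (h u - h z - (u - z) * l))) by (simpl; ring).
    eapply Rle_trans; [apply re_le_Cmod|]. rewrite Cmod_mult.
    generalize (Cmod_ge_0 c) (Cmod_ge_0 (u - z)); intros P Q.
    eapply Rle_trans; [apply Rmult_le_compat_l; [exact P|exact hd]|].
    assert (E : Cmod c / (Cmod c + 1) <= 1).
    { apply Rle_div_l; lra. }
    replace (Cmod c * (eps / (Cmod c + 1) * Cmod (u - z)))
      with (Cmod c / (Cmod c + 1) * (eps * Cmod (u - z))) by (field; lra).
    rewrite <- (Rmult_1_l (eps * Cmod (u - z))) at 2.
    apply Rmult_le_compat_r; [|exact E].
    apply Rmult_le_pos; [apply Rlt_le, cond_pos|exact Q].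
Qed.

(** Chain rule along a path given by coordinates; it serves both axis-parallel lines (for the
    Wirtinger derivatives) and circles (for the Lipschitz bound). *)
Lemma is_derive_Re_mult_path (h : C -> C) (l c : C) (x y : R -> R) (t dx dy : R)
  (hd : @is_derive C_AbsRing C_NormedModule h (x t, y t) l)
  (hx : is_derive x t dx) (hy : is_derive y t dy) :
  is_derive (fun s => Re (c * h (x s, y s))) t (Re (c * (l * (dx, dy)))).
Proof.
  eapply filterdiff_ext_lin.
  - apply (@filterdiff_comp'_2 R_AbsRing R_NormedModule R_NormedModule R_NormedModule R_NormedModule
      x y (fun u v => Re (c * h (u, v))) t _ _ (fun u v => Re (c * (l * (u, v)))) hx hy).
    apply (@filterdiff_ext_lin R_AbsRing C_R_NormedModule R_NormedModule _ _ _ (fun u : C => Re (c * (l * u)))).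
    + apply (@filterdiff_ext R_AbsRing C_R_NormedModule R_NormedModule _ _ (fun u : C => Re (c * h u))).
      * intros [u v]; reflexivity.
      * apply filterdiff_Re_mult, hd.
    + intros [u v]; reflexivity.
  - intros s. unfold scal; simpl; unfold mult; simpl. ring.
Qed.

(** * Lipschitz bound on circles *)

(** For nonzero [w] the rotation [c = Cconj w / Cmod w] turns [w] into [Cmod w]. *)
Lemma Cmod_le_of_Re (w : C) (M : R) :
  (forall c : C, Cmod c = 1 -> Re (c * w) <= M) -> Cmod w <= M.
Proof.
  intros H. destruct (Req_dec (Cmod w) 0) as [E|E].
  - rewrite E. specialize (H 1 Cmod_1). rewrite (Cmod_eq_0 _ E) in H. simpl in H. lra.
  - assert (Hw : w <> 0) by (intros ->; apply E, Cmod_0).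
    assert (Hr : RtoC (Cmod w) <> 0) by (intros F; apply E; injection F; auto).
    specialize (H (Cconj w / Cmod w)%C).
    replace (Cconj w / Cmod w * w)%C with (RtoC (Cmod w)) in H.
    + apply H. rewrite Cmod_div, Cmod_conj, Cmod_R, Rabs_pos_eq by (try apply Cmod_ge_0; auto).
      field; auto.
    + transitivity ((w * Cconj w) / Cmod w)%C; [|field; auto].
      rewrite <- Cmod2_conj, RtoC_pow. field; auto.
Qed.

Definition cis (t : R) : C := (cos t, sin t).

Lemma Cmod_cis (t : R) : Cmod (cis t) = 1.
Proof.
  rewrite <- sqrt_1. unfold Cmod, cis; simpl. f_equal.
  generalize (sin2_cos2 t). unfold Rsqr. lra.
Qed.

(** The mean value inequality is applied to the real function [Re (c * F)] along the circle, for
    each unimodular [c]; the path has speed [r], whence the constant [M * r]. *)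
Lemma circle_lipschitz (F : C -> C) (M r : R) (hM : 0 <= M) (hr : 0 <= r < 1)
  (hF : forall z, unit_disc z ->
     exists l, @is_derive C_AbsRing C_NormedModule F z l /\ Cmod l <= M) (s t : R) :
  Cmod (F (r * cis s)%C - F (r * cis t)%C) <= M * r * Rabs (s - t).
Proof.
  assert (Hcis : forall x, (r * cis x)%C = (r * cos x, r * sin x))
    by (intros x; unfold cis; apply injective_projections; simpl; ring).
  rewrite !Hcis. clear Hcis.
  apply Cmod_le_of_Re. intros c Hc.
  assert (Hcirc : forall a x, Cmod (a * - sin x, a * cos x) = Rabs a).
  { intros a x. unfold Cmod. simpl. rewrite <- sqrt_Rsqr_abs. f_equal.
    unfold Rsqr. generalize (sin2_cos2 x). unfold Rsqr. nra. }
  assert (Hd : forall x, exists l, @is_derive C_AbsRing C_NormedModule F (r * cos x, r * sin x) l /\ Cmod l <= M).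
  { intros x. apply hF. unfold unit_disc. unfold Cmod. simpl.
    replace (_ + _) with (r ^ 2 * (Rsqr (sin x) + Rsqr (cos x))) by (unfold Rsqr; ring).
    rewrite sin2_cos2, Rmult_1_r, sqrt_pow2; lra. }
  assert (Hd2 : forall x, exists l, is_derive (fun x => Re (c * F (r * cos x, r * sin x))) x l /\ Rabs l <= M * r).
  { intros x. destruct (Hd x) as [l [H1 H2]].
    exists (Re (c * (l * (r * - sin x, r * cos x)))). split.
    - apply (is_derive_Re_mult_path F l c (fun x => r * cos x) (fun x => r * sin x)); auto.
      + auto_derive; auto; ring.
      + auto_derive; auto; ring.
    - eapply Rle_trans; [apply re_le_Cmod|].
      rewrite !Cmod_mult, Hc, Hcirc, Rabs_pos_eq by lra. nra. }
  assert (HH : Rabs (Re (c * F (r * cos s, r * sin s)) - Re (c * F (r * cos t, r * sin t))) <= M * r * Rabs (s - t)).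
  { apply (bounded_variation (fun x => Re (c * F (r * cos x, r * sin x)))
      (Derive (fun x => Re (c * F (r * cos x, r * sin x))))).
    intros x _. destruct (Hd2 x) as [l [H1 H2]].
    cbv beta. rewrite (is_derive_unique _ _ _ H1 : Derive (fun x => Re (c * F (r * cos x, r * sin x))) x = l). auto. }
  eapply Rle_trans; [|exact HH].
  eapply Rle_trans; [|apply Rle_abs]. simpl. apply Req_le; ring.
Qed.

(** * Wirtinger derivatives and quasiregularity *)

(** The identity [Re (c * Cconj g) = Re (Cconj c * g)] reduces the antianalytic part to the analytic
    case. *)
Lemma Derive_Re_harmonic_path (f h g : C -> C) (c lh lg : C) (x y : R -> R) (t dx dy : R)
  (hfhg : forall z, unit_disc z -> f z = (h z + Cconj (g z))%C)
  (hz : unit_disc (x t, y t))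
  (dh : @is_derive C_AbsRing C_NormedModule h (x t, y t) lh)
  (dg : @is_derive C_AbsRing C_NormedModule g (x t, y t) lg)
  (hx : is_derive x t dx) (hy : is_derive y t dy) :
  Derive (fun s => Re (c * f (x s, y s))) t
  = Re (c * (lh * (dx, dy) + Cconj (lg * (dx, dy)))).
Proof.
  apply is_derive_unique.
  apply is_derive_ext_loc with
    (fun s => Re (c * h (x s, y s)) + Re (Cconj c * g (x s, y s))).
  (* The decomposition of [f] is given only inside the disc, so the path must stay there for [s]
     near [t]. *)
  - assert (L : locally t (fun s => x s ^ 2 + y s ^ 2 < 1)).
    { assert (Hc : continuous (fun s => x s ^ 2 + y s ^ 2) t).
      { apply (ex_derive_continuous (K := R_AbsRing) (V := R_NormedModule)).
        auto_derive. repeat split; eexists; eassumption. }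
      apply (Hc (fun r => r < 1)), (open_lt 1).
      unfold unit_disc, Cmod in hz. simpl in hz |- *.
      apply Rnot_le_lt. intros G. apply sqrt_le_1_alt in G. rewrite sqrt_1 in G.
      simpl in G. lra. }
    revert L. apply filter_imp. intros s Hs.
    rewrite hfhg.
    + simpl. ring.
    + unfold unit_disc, Cmod. rewrite <- sqrt_1. apply sqrt_lt_1_alt.
      simpl in Hs |- *. split; [nra|exact Hs].
  - replace (Re _) with (plus (Re (c * (lh * (dx, dy)))) (Re (Cconj c * (lg * (dx, dy))))).
    + apply (is_derive_plus (K := R_AbsRing) (V := R_NormedModule)); apply is_derive_Re_mult_path; auto.
    + unfold plus; simpl. ring.
Qed.

(** Horizontal and vertical paths give f_x = h' + conj g' and f_y = i (h' - conj g'); the Wirtinger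
    combinations separate the two terms. *)
Lemma wirtinger_harmonic (f h g : C -> C) (z lh lg : C)
  (hfhg : forall z, unit_disc z -> f z = (h z + Cconj (g z))%C)
  (hz : unit_disc z)
  (dh : @is_derive C_AbsRing C_NormedModule h z lh)
  (dg : @is_derive C_AbsRing C_NormedModule g z lg) :
  d_z f z = lh /\ d_zbar f z = Cconj lg.
Proof.
  destruct z as [x y].
  assert (Hx : forall c, Derive (fun s => Re (c * f (s, y))) x = Re (c * (lh + Cconj lg))).
  { intros c.
    rewrite (Derive_Re_harmonic_path f h g c lh lg (fun s => s) (fun _ => y) x 1 0); auto.
    - f_equal. apply injective_projections; simpl; ring.
    - apply (is_derive_id (K := R_AbsRing)).
    - apply (is_derive_const (K := R_AbsRing) (V := R_NormedModule)). }
  assert (Hy : forall c, Derive (fun s => Re (c * f (x, s))) y = Re (c * (Ci * (lh - Cconj lg)))).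
  { intros c.
    rewrite (Derive_Re_harmonic_path f h g c lh lg (fun _ => x) (fun s => s) y 0 1); auto.
    - f_equal. apply injective_projections; simpl; ring.
    - apply (is_derive_const (K := R_AbsRing) (V := R_NormedModule)).
    - apply (is_derive_id (K := R_AbsRing)). }
  assert (E1 : Cpartial_x f (x, y) = (lh + Cconj lg)%C).
  { unfold Cpartial_x, partial_x. apply injective_projections; simpl.
    - rewrite (Derive_ext _ (fun s => Re (1 * f (s, y)))) by (intros; unfold Re, Im; simpl; ring).
      rewrite Hx. simpl. ring.
    (* The imaginary part is reached with [c = - Ci], since [Re (- Ci * w) = Im w]. *)
    - rewrite (Derive_ext _ (fun s => Re (- Ci * f (s, y)))) by (intros; unfold Re, Im; simpl; ring).
      rewrite Hx. simpl. ring. }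
  assert (E2 : Cpartial_y f (x, y) = (Ci * (lh - Cconj lg))%C).
  { unfold Cpartial_y, partial_y. apply injective_projections; simpl.
    - rewrite (Derive_ext _ (fun s => Re (1 * f (x, s)))) by (intros; unfold Re, Im; simpl; ring).
      rewrite Hy. simpl. ring.
    - rewrite (Derive_ext _ (fun s => Re (- Ci * f (x, s)))) by (intros; unfold Re, Im; simpl; ring).
      rewrite Hy. simpl. ring. }
  unfold d_z, d_zbar. rewrite E1, E2.
  split; apply injective_projections; simpl; field.
Qed.

(** With p = |h'| and q = |g'|, sense preservation gives p > q, and (p + q)^2 <= K (p + q)(p - q)
    loses a factor p + q, leaving p + q <= K (p - q) <= K [lambda]. *)
Lemma quasiregular_derivative_bound (K lambda : R) (f h g : C -> C) (z lh lg : C)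
  (hK : 0 <= K) (hf : harmonic_quasiregular K f)
  (hfhg : forall z, unit_disc z -> f z = (h z + Cconj (g z))%C)
  (hlambda : forall z, unit_disc z -> lambda_min f z <= lambda)
  (hz : unit_disc z)
  (dh : @is_derive C_AbsRing C_NormedModule h z lh)
  (dg : @is_derive C_AbsRing C_NormedModule g z lg) :
  Cmod lh + Cmod lg <= K * lambda.
Proof.
  destruct hf as [_ [hs hq]].
  specialize (hs z hz). specialize (hq z hz). specialize (hlambda z hz).
  destruct (wirtinger_harmonic f h g z lh lg hfhg hz dh dg) as [E1 E2].
  unfold Lambda_max, Jacobian, lambda_min in *.
  rewrite E1, E2, Cmod_conj in *.
  generalize (Cmod_ge_0 lh) (Cmod_ge_0 lg). intros P Q.
  set (p := Cmod lh) in *. set (q := Cmod lg) in *.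
  assert (0 < p - q) by nra.
  rewrite Rabs_pos_eq in hlambda by lra.
  assert (p + q <= K * (p - q)) by (apply Rmult_le_reg_l with (p + q); nra).
  nra.
Qed.

(** The quotient of the directions of [u] and [v] turns [v] into the direction of [u]. This converts
    a bound on one coefficient of [h + c g] into a bound on |a_n| + |b_n|. *)
Lemma exists_aligning_rotation (u v : C) :
  exists c, Cmod c = 1 /\ Cmod (u + c * v) = Cmod u + Cmod v.
Proof.
  destruct (Ceq_dec u 0) as [->|Hu]; [|destruct (Ceq_dec v 0) as [->|Hv]].
  - exists 1. rewrite Cmod_1, Cmod_0, Cplus_0_l, Cmult_1_l. split; lra.
  - exists 1. rewrite Cmod_1, Cmod_0, Cmult_0_r, Cplus_0_r. split; lra.
  - assert (Pu := proj1 (Cmod_gt_0 u) Hu). assert (Pv := proj1 (Cmod_gt_0 v) Hv).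
    assert (Cu : RtoC (Cmod u) <> 0) by (intros F; injection F; lra).
    assert (Cv : RtoC (Cmod v) <> 0) by (intros F; injection F; lra).
    exists ((u / Cmod u) * (Cmod v / v))%C. split.
    + rewrite Cmod_mult, !Cmod_div, !Cmod_R, !Rabs_pos_eq by (auto; lra). field; lra.
    + replace (u + _)%C with (u / Cmod u * RtoC (Cmod u + Cmod v))%C.
      * rewrite Cmod_mult, Cmod_div, !Cmod_R, !Rabs_pos_eq by (auto; lra). field; lra.
      * rewrite RtoC_plus. field; auto.
Qed.

(** * Roots of unity and discrete orthogonality *)

Lemma cis_plus (s t : R) : cis (s + t) = (cis s * cis t)%C.
Proof.
  unfold cis. rewrite cos_plus, sin_plus.
  apply injective_projections; simpl; ring.
Qed.

Lemma cis_pow (t : R) (n : nat) : (cis t ^ n)%C = cis (INR n * t).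
Proof.
  induction n as [|n IH].
  - simpl. rewrite Rmult_0_l. unfold cis. rewrite cos_0, sin_0. reflexivity.
  - rewrite Cpow_S, IH, <- cis_plus. f_equal. rewrite S_INR. ring.
Qed.

Lemma cis_2PI_mult (k : nat) : cis (INR k * (2 * PI)) = 1.
Proof.
  rewrite <- cis_pow. unfold cis. rewrite cos_2PI, sin_2PI. apply Cpow_1_l.
Qed.

(** From cos t = 1 - 2 sin^2 (t/2), the value 1 would force sin (t/2) = 0, whereas 0 < |t|/2 <
    [PI]. *)
Lemma cis_neq_1 (t : R) : 0 < Rabs t < 2 * PI -> cis t <> 1.
Proof.
  intros [H1 H2] E. injection E as E _.
  replace t with (2 * (t / 2)) in E by field. rewrite cos_2a_sin in E.
  assert (Z : sin (t / 2) = 0) by nra.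
  destruct (Rle_or_lt 0 t) as [P|P].
  - rewrite Rabs_pos_eq in * by lra.
    generalize (sin_gt_0 (t / 2)). lra.
  - rewrite Rabs_left in * by lra.
    generalize (sin_gt_0 (- (t / 2))). rewrite sin_neg. lra.
Qed.

(** The geometric sum times w - 1 telescopes to w^(p+1) - 1 = 0, and w - 1 is nonzero. *)
Lemma sum_pow_root_of_unity (w : C) (p : nat) (hw : (w ^ S p)%C = 1) (hw1 : w <> 1) :
  @sum_n C_AbelianGroup (fun j => Cpow w j) p = RtoC 0.
Proof.
  assert (H : forall n, (@sum_n C_AbelianGroup (fun j => Cpow w j) n * (w - 1) = w ^ S n - 1)%C).
  { induction n as [|n IH].
    - rewrite sum_O. simpl. ring.
    - rewrite sum_Sn. unfold plus; simpl.
      rewrite Cmult_plus_distr_r, IH. simpl. ring. }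
  specialize (H p). rewrite hw in H.
  assert (Hn : (w - 1)%C <> 0).
  { intros E. apply hw1. replace w with ((w - 1) + 1)%C by ring. rewrite E. ring. }
  replace (1 - 1)%C with (RtoC 0) in H by ring.
  destruct (Ceq_dec (@sum_n C_AbelianGroup (fun j => Cpow w j) p) 0) as [E|E]; auto.
  exfalso. revert H. apply Cmult_neq_0; auto.
Qed.

Lemma sum_n_single {G : AbelianMonoid} (u : nat -> G) (m n : nat)
  (hm : (m <= n)%nat) (hu : forall k, (k <= n)%nat -> k <> m -> u k = zero) :
  sum_n u n = u m.
Proof.
  revert hm hu. induction n as [|n IH]; intros hm hu.
  - replace m with 0%nat by lia. apply sum_O.
  - rewrite sum_Sn. destruct (Nat.eq_dec m (S n)) as [->|E].
    + rewrite (sum_n_ext_loc u (fun _ => zero)) by (intros; apply hu; lia).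
      replace (sum_n _ n) with (@zero G); [apply plus_zero_l|].
      clear. induction n; [now rewrite sum_O|now rewrite sum_Sn, <- IHn, plus_zero_l].
    + rewrite IH, (hu (S n)), plus_zero_r; auto with arith. lia.
Qed.

(* Discrete orthogonality: sampling at the (q+2)-th roots of unity separates
   the exponents 1, ..., q+1. *)
Lemma sum_roots_of_unity_extract (c : nat -> C) (r : R) (q m : nat) (hm : (m <= q)%nat) :
  let x := 2 * PI / INR (S (S q)) in
  @sum_n C_AbelianGroup (fun j => (cis (- (INR (S m) * (INR j * x))) *
     @sum_n C_AbelianGroup (fun k => c (S k) * Cpow (r * cis (INR j * x)) (S k)) q))%C (S q)
  = (INR (S (S q)) * (c (S m) * r ^ S m))%C.
Proof.
  intros x.
  assert (HN : 0 < INR (S (S q))) by (apply lt_0_INR; lia).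
  (* For fixed [k] the combined phase is a [j]-th power, so after exchanging the sums each inner sum
     is geometric. *)
  rewrite (sum_n_ext _ (fun j => @sum_n C_AbelianGroup
    (fun k => (c (S k) * r ^ S k) * Cpow (cis ((INR (S k) - INR (S m)) * x)) j)%C q)).
  2:{ intros j. rewrite <- (sum_n_mult_l (K := C_Ring)). apply sum_n_ext. intros k.
      unfold mult; simpl (Ring.mult _ _).
      change (cis (- (INR (S m) * (INR j * x))) * (c (S k) * (r * cis (INR j * x)) ^ S k)
        = c (S k) * r ^ S k * cis ((INR (S k) - INR (S m)) * x) ^ j)%C.
      rewrite Cpow_mult_l, !cis_pow.
      replace (INR j * ((INR (S k) - INR (S m)) * x))
        with (- (INR (S m) * (INR j * x)) + INR (S k) * (INR j * x)) by ring.
      rewrite cis_plus. ring. }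
  rewrite sum_n_switch.
  rewrite (sum_n_single _ m q hm).
  - rewrite (sum_n_ext _ (fun _ => (c (S m) * r ^ S m)%C)).
    + set (v := (c (S m) * r ^ S m)%C). generalize (S q) as n.
      induction n as [|n IH].
      * rewrite sum_O. simpl. ring.
      * rewrite sum_Sn, IH. rewrite (S_INR (S n)), RtoC_plus. unfold plus; simpl. ring.
    + intros j. replace ((INR (S m) - INR (S m)) * x) with 0 by ring.
      rewrite cis_pow, Rmult_0_r. unfold cis. rewrite cos_0, sin_0.
      change (c (S m) * r ^ S m * 1 = c (S m) * r ^ S m)%C. ring.
  - intros k hk hkm.
    rewrite (sum_n_mult_l (K := C_Ring) (c (S k) * r ^ S k)%C).
    rewrite sum_pow_root_of_unity.
    + change (c (S k) * r ^ S k * 0 = 0)%C. ring.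
    + rewrite cis_pow. unfold x.
      replace (INR (S (S q)) * ((INR (S k) - INR (S m)) * (2 * PI / INR (S (S q)))))
        with (INR (S k) * (2 * PI) + - (INR (S m) * (2 * PI))) by (field; lra).
      (* [cis_2PI_mult] covers only natural multiples; the negative one is obtained as an
         inverse. *)
      assert (E := cis_plus (INR (S m) * (2 * PI)) (- (INR (S m) * (2 * PI)))).
      rewrite Rplus_opp_r in E.
      rewrite cis_plus, cis_2PI_mult. rewrite cis_2PI_mult in E. rewrite <- E.
      unfold cis. rewrite cos_0, sin_0. reflexivity.
    (* Distinct indices up to [q] differ by less than the number q + 2 of sample points, so the
       angle stays below a full turn. *)
    + apply cis_neq_1. unfold x. generalize PI_RGT_0; intros HP.
      assert (0 < Rabs (INR (S k) - INR (S m)) <= INR (S q)).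
      { destruct (Nat.lt_ge_cases k m) as [E|E].
        - rewrite Rabs_left by (apply Rlt_minus, lt_INR; lia).
          split; [apply lt_INR in E|]; rewrite !S_INR in *; [lra|].
          apply le_INR in hm. generalize (pos_INR k). lra.
        - assert (E' : (m < k)%nat) by lia. apply lt_INR in E'. apply le_INR in hk.
          rewrite !S_INR in *. rewrite Rabs_pos_eq by lra. generalize (pos_INR m). lra. }
      rewrite (S_INR (S q)) in *.
      rewrite Rabs_mult, (Rabs_pos_eq (_ / _)) by (apply Rlt_le, Rdiv_lt_0_compat; lra).
      split.
      * apply Rmult_lt_0_compat; [lra|]. apply Rdiv_lt_0_compat; lra.
      * apply Rmult_lt_reg_r with (INR (S q) + 1); [lra|].
        replace (Rabs (INR (S k) - INR (S m)) * (2 * PI / (INR (S q) + 1)) * (INR (S q) + 1))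
          with (Rabs (INR (S k) - INR (S m)) * (2 * PI)) by (field; lra). nra.
Qed.

(** * Cauchy's estimate and the coefficient bounds *)

Lemma norm_is_series_le {K : AbsRing} {V : NormedModule K} (a : nat -> V) (b : nat -> R)
  (la : V) (lb : R) (ha : is_series a la) (hb : is_series b lb)
  (hab : forall n, norm (a n) <= b n) : norm la <= lb.
Proof.
  apply (is_lim_seq_le (fun n => norm (sum_n a n)) (sum_n b) (norm la) lb).
  - intros n. unfold sum_n.
    eapply Rle_trans; [apply norm_sum_n_m|]. apply sum_n_m_le, hab.
  - eapply filterlim_comp; [exact ha|]. apply filterlim_norm.
  - exact hb.
Qed.

(** Abel's argument: convergence at a point [s] between [r] and 1 bounds the terms there by some
    [B], so on |z| = r the series is dominated by a geometric one of ratio [r / s], whose tails do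
    not depend on [z]. *)
Lemma power_series_uniform_on_circle (c : nat -> C) (G : C -> C) (r eps : R)
  (hG : power_series_from_1 unit_disc c G) (hr : 0 < r < 1) (heps : 0 < eps) :
  exists Q, forall q, (Q <= q)%nat -> forall z, Cmod z = r ->
    Cmod (G z - @sum_n C_AbelianGroup (fun k => c (S k) * Cpow z (S k))%C q) <= eps.
Proof.
  set (s := (1 + r) / 2).
  assert (hs : r < s < 1) by (unfold s; lra).
  assert (Hs : unit_disc s) by (unfold unit_disc; rewrite Cmod_R, Rabs_pos_eq; lra).
  assert (HB : exists B, 0 <= B /\ forall n, Cmod (c (S n)) * s ^ S n <= B).
  { set (u := fun n => (c (S n) * Cpow s (S n))%C).
    destruct (filterlim_bounded (K := C_AbsRing) (V := C_NormedModule)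
      (@sum_n C_AbelianGroup u)) as [B HB].
    { exists (G s). exact (hG s Hs). }
    assert (HB' : forall n, Cmod (@sum_n C_AbelianGroup u n) <= B) by exact HB.
    assert (HB0 : 0 <= B) by (eapply Rle_trans; [apply Cmod_ge_0|apply (HB' 0%nat)]).
    exists (B + B). split; [lra|]. intros n.
    replace (Cmod (c (S n)) * s ^ S n) with (Cmod (u n)).
    2:{ unfold u. rewrite Cmod_mult, Cmod_pow, Cmod_R, Rabs_pos_eq by lra. reflexivity. }
    destruct n as [|n].
    - specialize (HB' 0%nat). rewrite sum_O in HB'. lra.
    (* A term is the difference of two partial sums, each bounded by [B]; hence the witness
       [B + B]. *)
    - replace (u (S n)) with (@sum_n C_AbelianGroup u (S n) + - @sum_n C_AbelianGroup u n)%C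
        by (rewrite sum_Sn; unfold plus; simpl; ring).
      eapply Rle_trans; [apply Cmod_triangle|].
      rewrite Cmod_opp. apply Rplus_le_compat; apply HB'. }
  destruct HB as [B [HB0 HB]].
  set (t := r / s).
  assert (ht : 0 <= t < 1).
  { unfold t. split; [apply Rlt_le, Rdiv_lt_0_compat; lra|]. apply Rlt_div_l; lra. }
  assert (Hb : is_series (fun n => B * t ^ n) (B * / (1 - t))).
  { apply (is_series_scal_l (K := R_AbsRing) (V := R_NormedModule) B (fun n => t ^ n)).
    apply is_series_geom. rewrite Rabs_pos_eq; lra. }
  assert (Hterm : forall z n, Cmod z = r -> Cmod (c (S n) * Cpow z (S n)) <= B * t ^ n).
  { intros z n Hz. rewrite Cmod_mult, Cmod_pow, Hz.
    replace r with (s * t) by (unfold t; field; lra).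
    rewrite Rpow_mult_distr, <- Rmult_assoc.
    apply Rmult_le_compat; auto; try (apply pow_le; lra).
    - apply Rmult_le_pos; [apply Cmod_ge_0|apply pow_le; lra].
    (* The exponent is n + 1 on the left; the extra factor [t] is at most 1. *)
    - simpl. rewrite <- (Rmult_1_l (t ^ n)) at 2.
      apply Rmult_le_compat_r; [apply pow_le|]; lra. }
  assert (Hlim : is_lim_seq (sum_n (fun n => B * t ^ n)) (B * / (1 - t))) by exact Hb.
  apply is_lim_seq_spec in Hlim. specialize (Hlim (mkposreal _ heps)).
  destruct Hlim as [Q HQ]. exists Q. intros q hq z Hz.
  apply Rle_trans with (B * / (1 - t) - sum_n (fun n => B * t ^ n) q).
  - assert (HGz : unit_disc z) by (unfold unit_disc; lra).
    apply (norm_is_series_le (K := C_AbsRing) (V := C_NormedModule)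
      (fun k => c (S (S q + k)) * Cpow z (S (S q + k)))%C (fun k => B * t ^ (S q + k))).
    + apply (is_series_incr_n (K := C_AbsRing) (V := C_NormedModule)
        (fun k => c (S k) * Cpow z (S k))%C); [lia|].
      simpl Init.Nat.pred.
      match goal with |- is_series _ (plus (_ - ?P)%C _) =>
        replace (plus _ _) with (G z) by (change (G z = G z - P + P)%C; ring) end.
      apply hG, HGz.
    + apply (is_series_incr_n (K := R_AbsRing) (V := R_NormedModule)
        (fun k => B * t ^ k)); [lia|].
      simpl Init.Nat.pred.
      match goal with |- is_series _ (plus (_ - ?P) _) =>
        replace (plus _ _) with (B * / (1 - t))
          by (change (B * / (1 - t) = B * / (1 - t) - P + P); ring) end.
      exact Hb.
    + intros n. apply Hterm, Hz.
  - specialize (HQ q hq). simpl in HQ. apply Rabs_lt_between in HQ. lra.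
Qed.

(** The coefficient is an average, over roots of unity, of rotated values of a partial sum. Each
    value is within [eps] of a value of [G], hence at most [M + eps] in modulus. *)
Lemma cauchy_estimate (c : nat -> C) (G : C -> C) (r M : R) (m : nat)
  (hG : power_series_from_1 unit_disc c G) (hr : 0 < r < 1)
  (hM : forall t, Cmod (G (r * cis t)%C) <= M) :
  Cmod (c (S m)) * r ^ S m <= M.
Proof.
  apply le_epsilon. intros eps heps.
  destruct (power_series_uniform_on_circle c G r eps hG hr heps) as [Q HQ].
  (* Large enough both for the uniform error bound and for the partial sum to contain the exponent m
     + 1. *)
  set (q := (Q + m)%nat).
  assert (hq : (Q <= q)%nat) by (unfold q; lia).
  assert (hm : (m <= q)%nat) by (unfold q; lia).
  specialize (HQ q hq). clearbody q.
  assert (E := sum_roots_of_unity_extract c r q m hm). cbv zeta in E.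
  set (x := 2 * PI / INR (S (S q))) in E.
  assert (HN : 0 < INR (S (S q))) by (apply lt_0_INR; lia).
  apply Rmult_le_reg_l with (INR (S (S q))); auto.
  replace (INR (S (S q)) * (Cmod (c (S m)) * r ^ S m))
    with (Cmod (INR (S (S q)) * (c (S m) * r ^ S m))%C).
  2:{ rewrite !Cmod_mult, <- RtoC_pow, !Cmod_R.
      rewrite !Rabs_pos_eq by (try apply pow_le; lra). reflexivity. }
  rewrite <- E. clear E.
  rewrite <- sum_n_const.
  unfold sum_n at 1.
  eapply Rle_trans; [apply (norm_sum_n_m (K := C_AbsRing) (V := C_NormedModule))|].
  apply sum_n_m_le. intros j.
  match goal with |- norm (_ * ?P)%C <= _ => set (S := P) end.
  change (Cmod (cis (- (INR (Datatypes.S m) * (INR j * x))) * S) <= M + eps).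
  rewrite Cmod_mult, Cmod_cis, Rmult_1_l.
  set (z := (r * cis (INR j * x))%C) in *.
  replace S with (G z + - (G z - S))%C by ring.
  eapply Rle_trans; [apply Cmod_triangle|].
  rewrite Cmod_opp. apply Rplus_le_compat; [apply hM|apply HQ].
  unfold z. rewrite Cmod_mult, Cmod_cis, Cmod_R, Rabs_pos_eq; lra.
Qed.

(* Cauchy's estimate for the rotated difference F(e^{it} z) - F(z), whose
   coefficients are c_k (e^{ikt} - 1), divided by t -> 0; this replaces
   termwise differentiation of the series. *)
Lemma coefficient_bound_of_circle_lipschitz (c : nat -> C) (F : C -> C) (r L : R) (m : nat)
  (hF : power_series_from_1 unit_disc c F) (hr : 0 < r < 1)
  (hL : forall s t, Cmod (F (r * cis s)%C - F (r * cis t)%C) <= L * Rabs (s - t)) :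
  INR (S m) * (Cmod (c (S m)) * r ^ S m) <= L.
Proof.
  set (X := Cmod (c (S m)) * r ^ S m).
  assert (HX : 0 <= X) by (apply Rmult_le_pos; [apply Cmod_ge_0|apply pow_le; lra]).
  assert (Hm : 0 < INR (S m)) by (apply lt_0_INR; lia).
  assert (H : forall t, 0 < t -> X * sin (INR (S m) * t) <= L * t).
  { intros t ht.
    assert (HC : Cmod (c (S m) * (cis (INR (S m) * t) - 1)) * r ^ S m <= L * t).
    { apply (cauchy_estimate (fun k => c k * (cis (INR k * t) - 1))%C
        (fun z => F (cis t * z) - F z)%C); auto.
      - intros z Hz.
        assert (Hz' : unit_disc (cis t * z))
          by (unfold unit_disc; rewrite Cmod_mult, Cmod_cis, Rmult_1_l; exact Hz).
        eapply is_series_ext; [|apply (is_series_minus _ _ _ _ (hF _ Hz') (hF _ Hz))].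
        intros n. cbv beta. rewrite Cpow_mult_l, cis_pow.
        change (c (S n) * (cis (INR (S n) * t) * z ^ S n) - c (S n) * z ^ S n =
          c (S n) * (cis (INR (S n) * t) - 1) * z ^ S n)%C. ring.
      - intros s.
        replace (cis t * (r * cis s))%C with (r * cis (t + s))%C by (rewrite cis_plus; ring).
        eapply Rle_trans; [apply hL|]. right.
        replace (t + s - s) with t by ring. rewrite Rabs_pos_eq; lra. }
    eapply Rle_trans; [|exact HC].
    rewrite Cmod_mult.
    replace (Cmod (c (S m)) * Cmod (cis (INR (S m) * t) - 1) * r ^ S m)
      with (X * Cmod (cis (INR (S m) * t) - 1)) by (unfold X; ring).
    apply Rmult_le_compat_l; auto.
    (* The modulus of [cis u - 1] is bounded below by its imaginary part [sin u], which suffices to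
       first order in [t]. *)
    eapply Rle_trans; [apply Rle_abs|].
    eapply Rle_trans; [|apply Rmax_Cmod].
    eapply Rle_trans; [|apply Rmax_r].
    right. f_equal. simpl. ring. }
  assert (HL : is_lim (fun y => INR (S m) * X * (sin y / y)) 0 (INR (S m) * X * 1)).
  { apply (is_lim_scal_l (fun y => sin y / y) (INR (S m) * X) 0 1), is_lim_sinc_0. }
  assert (Hy : forall y, 0 < y -> INR (S m) * X * (sin y / y) <= L).
  { intros y hy.
    assert (hy' : 0 < y / INR (S m)) by (apply Rdiv_lt_0_compat; lra).
    specialize (H _ hy').
    replace (INR (S m) * (y / INR (S m))) with y in H by (field; lra).
    apply Rmult_le_reg_r with (y / INR (S m)); auto.
    replace (INR (S m) * X * (sin y / y) * (y / INR (S m))) with (X * sin y) by (field; lra).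
    exact H. }
  (* The inequality holds for positive [y], so the limit of [sin y / y] is taken from the right. *)
  assert (Hle : Rbar_le (INR (S m) * X * 1) L).
  { apply (filterlim_le (F := at_right 0) (fun y => INR (S m) * X * (sin y / y)) (fun _ => L)).
    - exists (mkposreal 1 Rlt_0_1). intros y _ hy. apply Hy, hy.
    - intros P HP. specialize (HL P HP). destruct HL as [d HL].
      exists d. intros y hy1 hy2. apply HL; [exact hy1|apply Rgt_not_eq, hy2].
    - apply filterlim_const. }
  change (INR (S m) * X * 1 <= L) in Hle. lra.
Qed.

(** On |z| = r the Lipschitz constant is [M * r], at most [M]; letting r tend to 1 removes the
    factor r^(m+1). *)
Lemma coefficient_bound_of_derivative_bound (c : nat -> C) (F : C -> C) (M : R) (m : nat)
  (hM : 0 <= M) (hF : power_series_from_1 unit_disc c F)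
  (hd : forall z, unit_disc z ->
     exists l, @is_derive C_AbsRing C_NormedModule F z l /\ Cmod l <= M) :
  INR (S m) * Cmod (c (S m)) <= M.
Proof.
  set (X := INR (S m) * Cmod (c (S m))).
  assert (H : forall r, 0 < r < 1 -> X * r ^ S m <= M).
  { intros r hr. apply Rle_trans with (M * r); [|nra].
    unfold X. rewrite Rmult_assoc.
    apply coefficient_bound_of_circle_lipschitz with F; auto.
    apply circle_lipschitz; auto; lra. }
  assert (Hle : Rbar_le (X * 1 ^ S m) M).
  { apply (filterlim_le (F := at_left 1) (fun r => X * r ^ S m) (fun _ => M)).
    - exists (mkposreal 1 Rlt_0_1). intros r hr1 hr2. apply H.
      change (Rabs (r - 1) < 1) in hr1. apply Rabs_lt_between in hr1.
      split; [lra|exact hr2].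
    - assert (Hc : continuous (fun r => X * r ^ S m) 1).
      { apply (ex_derive_continuous (K := R_AbsRing) (V := R_NormedModule)).
        auto_derive. auto. }
      intros P HP. destruct (Hc P HP) as [d Hd].
      exists d. intros y Hy _. apply Hd, Hy.
    - apply filterlim_const. }
  change (X * 1 ^ S m <= M) in Hle. rewrite pow1 in Hle. lra.
Qed.

Theorem corollary2p4 (K : R) (hK : 1 <= K)
  (f h g : C -> C) (a b : nat -> C)
  (hf : harmonic_quasiregular K f)
  (hh : analytic_on unit_disc h)
  (hg : analytic_on unit_disc g)
  (ha : power_series_from_1 unit_disc a h)
  (hb : power_series_from_1 unit_disc b g)
  (hfhg : forall z : C, unit_disc z -> f z = (h z + Cconj (g z))%C)
  (lambda : R)
  (hlambda : forall z : C, unit_disc z -> lambda_min f z <= lambda) :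
  forall n : nat, (1 <= n)%nat ->
    Cmod (a n) + Cmod (b n) <= K * lambda / INR n.
Proof.
  intros n hn. destruct n as [|m]; [lia|].
  assert (HM : forall z lh lg, unit_disc z ->
    @is_derive C_AbsRing C_NormedModule h z lh ->
    @is_derive C_AbsRing C_NormedModule g z lg -> Cmod lh + Cmod lg <= K * lambda).
  { intros z lh lg hz dh dg.
    apply (quasiregular_derivative_bound K lambda f h g z); auto. lra. }
  (* The sign comes from evaluating the derivative bound at the origin. *)
  assert (HM0 : 0 <= K * lambda).
  { assert (h0 : unit_disc 0) by (unfold unit_disc; rewrite Cmod_0; lra).
    destruct (hh _ h0) as [lh dh], (hg _ h0) as [lg dg].
    specialize (HM _ _ _ h0 dh dg).
    generalize (Cmod_ge_0 lh) (Cmod_ge_0 lg). lra. }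
  (* The rotation is chosen for this one index; the derivative bound for [h + c g] is the same for
     every unimodular [c]. *)
  destruct (exists_aligning_rotation (a (S m)) (b (S m))) as [c [hc1 hc2]].
  assert (Hm : 0 < INR (S m)) by (apply lt_0_INR; lia).
  apply Rle_div_r; [exact Hm|]. rewrite Rmult_comm, <- hc2.
  apply (coefficient_bound_of_derivative_bound (fun k => a k + c * b k)%C
    (fun z => h z + c * g z)%C); auto.
  - intros z hz.
    eapply is_series_ext;
      [|apply (is_series_plus _ _ _ _ (ha z hz)
          (is_series_scal_l (K := C_AbsRing) (V := C_NormedModule) c _ _ (hb z hz)))].
    intros k. change (a (S k) * z ^ S k + c * (b (S k) * z ^ S k)
      = (a (S k) + c * b (S k)) * z ^ S k)%C. ring.
  - intros z hz. destruct (hh z hz) as [lh dh], (hg z hz) as [lg dg].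
    exists (lh + c * lg)%C. split.
    + apply (is_derive_plus (K := C_AbsRing) (V := C_NormedModule) h (fun z => c * g z)%C); auto.
      eapply filterdiff_ext_lin.
      * exact (@filterdiff_scal_r_fct C_AbsRing (AbsRing_NormedModule C_AbsRing) C_NormedModule
          _ _ c g _ Cmult_comm dg).
      * intros w. change (c * (w * lg) = w * (c * lg))%C. ring.
    + eapply Rle_trans; [apply Cmod_triangle|].
      rewrite Cmod_mult, hc1, Rmult_1_l. apply (HM z); auto.
Qed.
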